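(* Let $p\in(2,\infty)$. Given an eigenpair $(\lambda,f)$ of the $p$-Laplacian $\Delta_p$ on $\mathcal H(V\setminus B)$ and the weights $\nu=|f|^{p-2}$ on $V\setminus B$ and $\mu=|\nabla f|^{p-2}$ on $\tilde E$, assume that $(\lambda,f)=(\lambda_{(\mu,\nu),k},f_{(\mu,\nu),k})$, the $k$-th eigenpair of the $(\mu,\nu)$-weighted Laplacian eigenvalue problem, has multiplicity $m$. Then $$\mathcal{MI}_f(\mathcal R_p)=\mathcal{MI}_f(\mathcal R_{2,\mu,\nu})=k-1,\qquad \mathcal{MI}_f(-\mathcal R_p)=\mathcal{MI}_f(-\mathcal R_{2,\mu,\nu})=N-k-m+1 .$$
   Context: $G=(V,E,\omega)$ is a finite non-oriented graph: $(u,v)\in E$ iff $(v,u)\in E$, with edge weights $\omega_{uv}=\omega_{vu}$. $B\subset V$ is a (possibly empty) subset called the boundary, $V\setminus B$ are the internal nodes and $N=|V\setminus B|$. $G$ is assumed connected, meaning that the subgraph induced by $V\setminus B$ is connected. $\tilde E\subset E$ contains exactly one orientation of each edge. $\mathcal H(V\setminus B)$ and $\mathcal H(\tilde E)$ are the spaces of real functions on $V\setminus B$ and $\tilde E$. For $f\in\mathcal H(V\setminus B)$, extended by $0$ on $B$, set $\nabla f(u,v)=\omega_{uv}(f(v)-f(u))$; $\nabla:\mathcal H(V\setminus B)\to\mathcal H(\tilde E)$ is linear with transpose $\nabla^T$. Absolute values, powers and the product $\odot$ are entrywise. $p$-Laplacian: $\Delta_p f=\nabla^T(|\nabla f|^{p-2}\odot\nabla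 f)$. A pair $(\lambda,f)$ with $f\neq0$ is a $p$-Laplacian eigenpair if $\Delta_p f(u)=\lambda|f(u)|^{p-2}f(u)$ for all $u\in V\setminus B$; equivalently it is a critical value/point of $\mathcal R_p(f)=\|\nabla f\|_p^p/\|f\|_p^p$, where $\|\nabla f\|_p^p=\sum_{(u,v)\in\tilde E}|\nabla f(u,v)|^p$ and $\|f\|_p^p=\sum_{u\in V\setminus B}|f(u)|^p$. For nonnegative weights $\mu$ on $\tilde E$ and $\nu$ on $V\setminus B$, let $\Delta_\mu=\nabla^T\mathrm{diag}(\mu)\nabla$, $\|g\|_{2,\nu}^2=\sum_u\nu_u|g(u)|^2$, $\|H\|_{2,\mu}^2=\sum_{(u,v)\in\tilde E}\mu_{uv}|H(u,v)|^2$, and $\mathcal R_{2,\mu,\nu}(g)=\|\nabla g\|_{2,\mu}^2/\|g\|_{2,\nu}^2$, which is well defined with values in $[0,\infty]$ for nonzero $g\in(\ker\mathrm{diag}(\nu)\cap\ker\Delta_\mu)^\perp$. The $(\mu,\nu)$-weighted Laplacian eigenvalue problem is $\Delta_\mu f=\lambda\,\mathrm{diag}(\nu)f$; if $(\lambda,f)$ is a $p$-Laplacian eigenpair and $\mu=|\nabla f|^{p-2}$, $\nu=|f|^{p-2}$, then $(\lambda,f)$ solves it. Its well defined eigenvalues, possibly equal to infinity, are $$\lambda_{(\mu,\nu),k}=\min_{A}\max_{0\ne g\in A}\mathcal R_{2,\mu,\nu}(g),\qquad 1\le k\le N-\dim(\ker\mathrm{diag}(\nu)\cap\ker\Delta_\mu),$$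 $A$ ranging over linear subspaces of $(\ker\mathrm{diag}(\nu)\cap\ker\Delta_\mu)^\perp$ with $\dim A\ge k$; $f_{(\mu,\nu),k}$ denotes a corresponding eigenfunction. The multiplicity of a $(\mu,\nu)$-eigenvalue $\lambda$ is $\dim\{g:\Delta_\mu g=\lambda\,\mathrm{diag}(\nu)g\}$ (so it also takes into account the dimension of $\ker\Delta_\mu\cap\ker\mathrm{diag}(\nu)$). The Morse index $\mathcal{MI}_x(\phi)$ of a function $\phi$ at $x$ is the dimension of the largest subspace on which the Hessian of $\phi$ at $x$ is negative definite.
   Formalization: The formal theorem assumes in addition that k is the first index carrying the eigenvalue, i.e. λ_{(μ,ν),j} < λ_{(μ,ν),k} for all 1 ≤ j < k; for a repeated eigenvalue and a later index k the claimed formulas fail. *)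

(* Defs.v *)
From HB Require Import structures.
From mathcomp Require Import all_boot all_order all_algebra.
From mathcomp Require Import all_classical all_reals all_analysis.
From mathcomp Require Import ring.
Import Order.TTheory GRing.Theory Num.Theory.
Import numFieldNormedType.Exports.

Set Implicit Arguments.
Unset Strict Implicit.
Unset Printing Implicit Defensive.

Local Open Scope classical_set_scope.
Local Open Scope ring_scope.

(* Loops (u, u) are not excluded: the gradient vanishes on them. *)
Record graph (R : realType) (V : finType) := Graph {
  edge : rel V;
  weight : V -> V -> R;
  boundary : {set V};
  orient : {set V * V};
  edge_sym : forall u v, edge u v = edge v u;
  weight_sym : forall u v, weight u v = weight v u;
  inner_connected : forall u v, u \notin boundary -> v \notin boundary ->
    connect [rel x y | [&& edge x y, x \notin boundary & y \notin boundary]]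
      u v;
  orient_edge : forall u v, (u, v) \in orient -> edge u v;
  orient_total : forall u v,
    edge u v -> ((u, v) \in orient) || ((v, u) \in orient);
  orient_anti : forall u v,
    (u, v) \in orient -> (v, u) \in orient -> u = v
}.

Section Calculus.
Context {R : realType} {V : finType} (G : graph R V).

Definition nb_inner : nat := #|~: boundary G|.
Definition nb_edges : nat := #|orient G|.

(* Functions are row vectors: coordinate i stands for the internal node
   enum_val i, resp. for the oriented edge enum_val e. *)
Definition nodefun := 'rV[R]_nb_inner.
Definition edgefun := 'rV[R]_nb_edges.

Definition inner_node (i : 'I_nb_inner) : V := enum_val i.
Definition oriented_edge (e : 'I_nb_edges) : V * V := enum_val e.

(* The sum has one term if v is an internal node, none if v is in the
   boundary. *)
Definition extend0 (f : nodefun) (v : V) : R :=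
  \sum_(i | inner_node i == v) f 0 i.

Definition grad (f : nodefun) : edgefun :=
  \row_e let: (u, v) := oriented_edge e in
         weight G u v * (extend0 f v - extend0 f u).

Lemma grad_is_linear : linear grad.
Proof.
move=> a f g; apply/rowP => e; rewrite !mxE; case: (oriented_edge e) => u v.
have extD w : extend0 (a *: f + g) w = a * extend0 f w + extend0 g w.
  rewrite /extend0 mulr_sumr -big_split; apply: eq_bigr => i _.
  by rewrite !mxE.
by rewrite !extD; ring.
Qed.

HB.instance Definition _ :=
  GRing.isLinear.Build R nodefun edgefun _ grad grad_is_linear.

(* Matrices act on row vectors from the right. *)
Definition gradmx : 'M[R]_(nb_inner, nb_edges) := lin1_mx grad.

Lemma gradE f : grad f = f *m gradmx.
Proof. by rewrite mul_rV_lin1. Qed.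

Definition gradT (h : edgefun) : nodefun := h *m gradmx^T.

Definition abs_pow {n} (q : R) (x : 'rV[R]_n) : 'rV[R]_n :=
  map_mx (fun t => `|t| `^ q) x.

Definition pLaplacian (p : R) (f : nodefun) : nodefun :=
  gradT (map2_mx *%R (abs_pow (p - 2) (grad f)) (grad f)).

Definition p_eigenpair (p lam : R) (f : nodefun) : Prop :=
  f != 0 /\
  forall i, pLaplacian p f 0 i = lam * `|f 0 i| `^ (p - 2) * f 0 i.

Definition pRayleigh (p : R) (f : nodefun) : R :=
  (\sum_e `|grad f 0 e| `^ p) / (\sum_i `|f 0 i| `^ p).

Section Weighted.
Variables (mu : edgefun) (nu : nodefun).

Definition sqnorm {n} (w x : 'rV[R]_n) : R := \sum_i w 0 i * `|x 0 i| ^+ 2.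

(* The inverse of 0 is +oo in \bar R, so a positive number over 0 is +oo. *)
Definition wRayleigh (g : nodefun) : \bar R :=
  ((sqnorm mu (grad g))%:E / (sqnorm nu g)%:E)%E.

Definition wLaplacian : 'M[R]_nb_inner :=
  gradmx *m diag_mx mu *m gradmx^T.

Definition common_ker : 'M[R]_nb_inner :=
  (kermx (diag_mx nu) :&: kermx wLaplacian)%MS.

Definition w_eigenpair (lam : R) (f : nodefun) : Prop :=
  f != 0 /\ f *m wLaplacian = lam *: (f *m diag_mx nu).

(* A linear subspace is the row space of a square matrix A; the equation
   A *m common_ker^T = 0 says that it is orthogonal to the common kernel.
   For k in the admissible range the infimum and the suprema are attained. *)
Definition w_eigenvalue (k : nat) : \bar R :=
  ereal_inf
    [set ereal_sup [set wRayleigh g | g in [set g | g != 0 /\ (g <= A)%MS]]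
    | A in [set A : 'M[R]_nb_inner |
            A *m common_ker^T = 0 /\ (k <= \rank A)%N]].

Definition w_multiplicity (lam : R) : nat :=
  \rank (kermx (wLaplacian - lam *: diag_mx nu)).

End Weighted.
End Calculus.

Section Morse.
Context {R : realType} {n : nat}.

Definition hessian (phi : 'rV[R]_n -> R) (x u v : 'rV[R]_n) : R :=
  'D_u (fun y => 'D_v phi y) x.

Definition hessian_neg_definite_on (phi : 'rV[R]_n -> R) (x : 'rV[R]_n)
    (A : 'M[R]_n) : Prop :=
  forall u, u != 0 -> (u <= A)%MS -> hessian phi x u u < 0.

Definition morse_index (phi : 'rV[R]_n -> R) (x : 'rV[R]_n) : nat :=
  \max_(d < n.+1 | `[< exists A : 'M[R]_n,
      \rank A = d /\ hessian_neg_definite_on phi x A >]) d.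

End Morse.

(* Main.v *)
Require Import Defs.
From mathcomp Require Import all_boot all_order all_algebra.
From mathcomp Require Import all_classical all_reals all_analysis.
From mathcomp Require Import ring lra zify.
Import Order.TTheory GRing.Theory Num.Theory.
Import numFieldNormedType.Exports.

(** All four Morse indices are read off one symmetric matrix, the pencil
    Q = L - lam W, where L is the (mu, nu)-weighted Laplacian and
    W = diag nu.

    Both Rayleigh quotients have the form A / B, where A and B are weighted
    sums of phi over the entries of the gradient and of the function, and phi
    is |x|^p or x^2.  On a line f + t u everything is a function of one real
    variable, and phi is twice differentiable because p > 2.  At an
    eigenfunction A = lam B and A' = lam B', so that the second derivative of
    the quotient is (A'' - lam B'') / B.  The second derivative of |x|^p is
    p (p - 1) |x|^(p-2), which is how the weights mu and nu appear: the Hessian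
    of either quotient is a positive multiple of the quadratic form of Q
    ([hessian_pRayleigh], [hessian_wRayleigh]).  Hence the Morse index is the
    negative index of Q, and of -Q for the opposite functions.

    The negative index of Q is k - 1 by the min-max formula
    ([negative_index_pencil]): orthogonally to the common kernel of L and W, the
    form of Q is negative at a nonzero vector exactly when the weighted Rayleigh
    quotient is less than lam.  The multiplicity m is by definition the
    dimension of the kernel of Q, so the positive index is N - (k - 1) - m by
    Sylvester's law ([inertia]). *)

Set Implicit Arguments.
Unset Strict Implicit.
Unset Printing Implicit Defensive.

Local Open Scope ring_scope.

(** * Quadratic forms and their inertia *)

(** Close to 0 a nonzero linear term would dominate the quadratic one, and it
    changes sign. *)
Lemma linear_coef_eq0 {R : realFieldType} (c b : R) :
  0 <= c -> (forall t, 0 <= t ^+ 2 * c + 2 * t * b) -> b = 0.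
Proof.
move=> c0 /(_ (- b / (c + 1))); have c1 : c + 1 != 0 by lra.
(* This t is the minimizer when c is replaced by c + 1, which is nonzero. *)
rewrite (_ : _ + _ = - (b ^+ 2 * ((c + 2) / (c + 1) ^+ 2))); last by field.
have h : 0 < (c + 2) / (c + 1) ^+ 2 by rewrite divr_gt0 ?exprn_gt0//; lra.
rewrite oppr_ge0 pmulr_lle0// => b0.
by apply/eqP; rewrite -sqrf_eq0 eq_le b0 sqr_ge0.
Qed.

Section QuadraticForms.
Context {R : realType} {n : nat}.
Implicit Types (Q : 'M[R]_n) (u v w : 'rV[R]_n).

Definition bform Q u v : R := (u *m Q *m v^T) 0 0.

Lemma bformDl Q u v w : bform Q (u + v) w = bform Q u w + bform Q v w.
Proof. by rewrite /bform !mulmxDl mxE. Qed.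

Lemma bformDr Q u v w : bform Q w (u + v) = bform Q w u + bform Q w v.
Proof. by rewrite /bform linearD mulmxDr mxE. Qed.

Lemma bformZl Q a u v : bform Q (a *: u) v = a * bform Q u v.
Proof. by rewrite /bform -!scalemxAl mxE. Qed.

Lemma bformZr Q a u v : bform Q u (a *: v) = a * bform Q u v.
Proof. by rewrite /bform linearZ -scalemxAr mxE. Qed.

Lemma bformN Q u v : bform (- Q) u v = - bform Q u v.
Proof. by rewrite /bform mulmxN mulNmx mxE. Qed.

Lemma bformC Q u v : Q^T = Q -> bform Q u v = bform Q v u.
Proof.
move=> Qs; rewrite /bform -[v *m Q *m u^T]trmxK [RHS]mxE.
by rewrite !trmx_mul trmxK Qs mulmxA.
Qed.

Lemma bform_kerl Q u v : u *m Q = 0 -> bform Q u v = 0.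
Proof. by rewrite /bform => ->; rewrite mul0mx mxE. Qed.

Definition neg_definite_on Q {m} (A : 'M[R]_(m, n)) : Prop :=
  forall u, u != 0 -> (u <= A)%MS -> bform Q u u < 0.

Definition negative_index Q : nat :=
  \max_(d < n.+1 | `[< exists A : 'M[R]_n,
      \rank A = d /\ neg_definite_on Q A >]) d.

Lemma rank_le_negative_index Q m (A : 'M[R]_(m, n)) :
  neg_definite_on Q A -> (\rank A <= negative_index Q)%N.
Proof.
move=> A_neg; have rA : (\rank A < n.+1)%N by rewrite ltnS rank_leq_col.
apply: (@leq_bigmax_cond _ _ (fun d : 'I_n.+1 => nat_of_ord d) (Ordinal rA)).
apply/asboolP; exists <<A>>%MS; split=> [|u u0]; first by rewrite /= genmxE.
by rewrite genmxE; exact: A_neg.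
Qed.

Lemma negative_index_attained Q :
  exists2 A : 'M[R]_n, \rank A = negative_index Q & neg_definite_on Q A.
Proof.
pose P (d : 'I_n.+1) := `[< exists A : 'M[R]_n,
  \rank A = d /\ neg_definite_on Q A >].
have P0 : P ord0.
  apply/asboolP; exists 0; split=> [|u u0]; first by rewrite mxrank0.
  by rewrite submx0 (negPf u0).
have [|d /asboolP[A [rA A_neg]] maxd] :=
  @eq_bigmax_cond _ P (fun d : 'I_n.+1 => nat_of_ord d).
  by apply/card_gt0P; exists ord0.
by exists A; rewrite // rA /negative_index maxd.
Qed.

(** The degenerate case of the Cauchy-Schwarz inequality: a small perturbation
    of the isotropic vector [u] in the direction [v] would otherwise make the
    form negative. *)
Lemma isotropic_orthogonal Q m (A : 'M[R]_(m, n)) u v :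
  Q^T = Q -> (forall w, (w <= A)%MS -> 0 <= bform Q w w) ->
  (u <= A)%MS -> (v <= A)%MS -> bform Q u u = 0 -> bform Q u v = 0.
Proof.
move=> Qs A_ge0 uA vA u0.
have q t : 0 <= t ^+ 2 * bform Q v v + 2 * t * bform Q u v.
  have := A_ge0 (u + t *: v) (addmx_sub uA (scalemx_sub _ vA)).
  rewrite !(bformDl, bformDr, bformZl, bformZr) u0 (bformC v u Qs).
  by congr (0 <= _); ring.
set b := bform Q u v in q *; set c := bform Q v v in q.
by apply: linear_coef_eq0 q; exact: A_ge0.
Qed.

Lemma neg_definite_on_cap Q m1 m2 (A : 'M[R]_(m1, n)) (B : 'M[R]_(m2, n)) :
  neg_definite_on Q A -> (forall w, (w <= B)%MS -> 0 <= bform Q w w) ->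
  (A :&: B)%MS = 0.
Proof.
move=> A_neg B_ge0; apply/eqP; rewrite -submx0; apply/rV_subP => u.
rewrite sub_capmx => /andP[uA uB]; rewrite submx0; apply: contraT => u0.
by have := A_neg _ u0 uA; rewrite ltNge B_ge0.
Qed.

(** If [A] is a negative definite subspace of largest dimension, the form is
    nonnegative on its orthogonal: a vector there with a negative value could
    be added to [A]. *)
Lemma orthogonal_maximal_ge0 Q (A : 'M[R]_n) w :
  Q^T = Q -> \rank A = negative_index Q -> neg_definite_on Q A ->
  w *m Q *m A^T = 0 -> 0 <= bform Q w w.
Proof.
move=> Qs rA A_neg wA; rewrite leNgt; apply/negP => w_neg.
have orth a : (a <= A)%MS -> bform Q w a = 0.
  by case/submxP => D ->; rewrite /bform trmx_mul mulmxA wA mul0mx mxE.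
have w_notin : ~~ (w <= A)%MS.
  by apply/negP => /orth; apply/eqP; rewrite lt_eqF.
have Aw_neg : neg_definite_on Q (A + w)%MS.
  move=> u u0 /sub_addsmxP[[D E]] /= uE.
  have aA : (D *m A <= A)%MS by exact: submxMl.
  have [t Et] : exists t, E *m w = t *: w.
    by exists (E 0 0); rewrite [E]mx11_scalar mul_scalar_mx mxE eqxx mulr1n.
  rewrite uE Et !(bformDl, bformDr, bformZl, bformZr) (orth _ aA).
  rewrite (bformC _ w Qs) (orth _ aA) !mulr0 addr0 add0r mulrA -expr2.
  have [a0|a0] := eqVneq (D *m A) 0; last first.
    by rewrite ltr_wnDr ?A_neg// mulr_ge0_le0 ?sqr_ge0// ltW.
  rewrite a0 bform_kerl ?mul0mx// add0r pmulr_rlt0//.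
  rewrite lt0r sqrf_eq0 sqr_ge0 andbT.
  by apply: contraNneq u0 => t0; rewrite uE a0 Et t0 scale0r addr0.
have := rank_le_negative_index Aw_neg; rewrite -rA.
rewrite (geq_leqif (mxrank_leqif_sup (addsmxSl A w))).
move=> AwA; move/negP: w_notin; apply.
exact: submx_trans (addsmxSr A w) AwA.
Qed.

(** Sylvester's law of inertia.  Let [A] be negative definite of largest
    dimension and [O] its orthogonal for the form.  The form is nonnegative on
    [O], and [A] and [O] span the space, so a complement of the kernel in [O] is
    positive definite: the three dimensions add up to at least [n].  They add up
    to at most [n] because a positive definite subspace meets [A] plus the
    kernel, where the form is nonpositive, only in 0. *)
Lemma inertia Q : Q^T = Q ->
  (negative_index Q + \rank (kermx Q) + negative_index (- Q))%N = n.
Proof.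
move=> Qs.
have [A rA A_neg] := negative_index_attained Q.
have [P rP P_neg] := negative_index_attained (- Q).
have kerQ w : (w <= kermx Q)%MS -> bform Q w w = 0.
  by move/sub_kermxP => w0; rewrite bform_kerl.
have AK0 : (A :&: kermx Q)%MS = 0.
  by apply: neg_definite_on_cap A_neg _ => w /kerQ ->.
have rAK : \rank (A + kermx Q)%MS = (negative_index Q + \rank (kermx Q))%N.
  by have := mxrank_sum_cap A (kermx Q); rewrite AK0 mxrank0 addn0 rA.
apply/eqP; rewrite eqn_leq; apply/andP; split.
  have PAK0 : (P :&: (A + kermx Q))%MS = 0.
    apply: neg_definite_on_cap P_neg _ => w /sub_addsmxP[[D E]] /= ->.
    have EK : E *m kermx Q *m Q = 0 by rewrite -mulmxA mulmx_ker mulmx0.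
    rewrite bformN oppr_ge0 !(bformDl, bformDr).
    rewrite [bform Q (D *m _) (E *m _)]bformC//.
    rewrite ![bform Q (E *m _) _]bform_kerl//.
    rewrite !addr0; have [->|a0] := eqVneq (D *m A) 0.
      by rewrite bform_kerl// mul0mx.
    by rewrite ltW// A_neg// submxMl.
  have := mxrank_sum_cap P (A + kermx Q)%MS; rewrite PAK0 mxrank0 addn0 rP rAK.
  by rewrite addnC => <-; exact: rank_leq_col.
pose O := kermx (Q *m A^T).
have O_orth w : (w <= O)%MS -> w *m Q *m A^T = 0.
  by move/sub_kermxP; rewrite mulmxA.
have O_ge0 w : (w <= O)%MS -> 0 <= bform Q w w.
  by move=> /O_orth; exact: orthogonal_maximal_ge0.
have rO : (n - negative_index Q <= \rank O)%N.
  rewrite mxrank_ker leq_sub2l// -rA -(mxrank_tr A); exact: mxrankM_maxr.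
have AO0 : (A :&: O)%MS = 0 by exact: neg_definite_on_cap A_neg O_ge0.
have AO1 : (1%:M <= A + O)%MS.
  rewrite sub1mx -col_leq_rank.
  have := mxrank_sum_cap A O; rewrite AO0 mxrank0 addn0 => ->.
  by rewrite rA -leq_subLR.
have KO : (kermx Q <= O)%MS.
  by apply/sub_kermxP; rewrite mulmxA mulmx_ker mul0mx.
(* An isotropic vector of O is orthogonal to O, and to A by definition of O,
   hence to the whole space. *)
have O_iso w : (w <= O)%MS -> bform Q w w = 0 -> w *m Q = 0.
  move=> wO w0; suff h v : bform Q w v = 0.
    apply/rowP => j; have := h (delta_mx 0 j).
    by rewrite /bform trmx_delta -colE !mxE.
  have /sub_addsmxP[[D E] ->] /= := submx_trans (submx1 v) AO1.
  rewrite bformDr.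
  rewrite [X in _ + X](isotropic_orthogonal Qs O_ge0)// ?submxMl//.
  by rewrite /bform trmx_mul mulmxA O_orth// mul0mx mxE addr0.
have C_pos : neg_definite_on (- Q) (O :\: kermx Q)%MS.
  move=> u u0 uC; rewrite bformN oppr_lt0 lt0r.
  have uO : (u <= O)%MS by exact: submx_trans uC (diffmxSl _ _).
  rewrite O_ge0// andbT; apply: contraNneq u0 => /(O_iso u uO)/sub_kermxP uK.
  by rewrite -submx0 -(capmx_diff O (kermx Q)) sub_capmx uC.
have := rank_le_negative_index C_pos.
have := mxrank_cap_compl O (kermx Q); rewrite (capmx_idPr KO).
move: rO; lia.
Qed.

End QuadraticForms.

(** * The min-max eigenvalues and the index of the pencil *)

Section QuotientMax.
Context {R : realType}.

Lemma bformE n (Q : 'M[R]_n) u v :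
  bform Q u v = \sum_j (\sum_i u 0 i * Q i j) * v 0 j.
Proof.
by rewrite /bform mxE; apply: eq_bigr => j _; rewrite !mxE.
Qed.

Lemma bform_comp n r (Q : 'M[R]_n) (M : 'M[R]_(r, n)) c d :
  bform (M *m Q *m M^T) c d = bform Q (c *m M) (d *m M).
Proof. by rewrite /bform trmx_mul !mulmxA. Qed.

Lemma continuous_sum_fun (T : topologicalType) n (F : 'I_n -> T -> R) :
  (forall i, continuous (F i)) -> continuous (fun x => \sum_i F i x).
Proof.
move=> Fc; have -> : (fun x => \sum_i F i x) = \sum_i F i.
  by apply/funext => x; rewrite fct_sumE.
elim/big_ind : _ => // [x|f g fc gc x]; first exact: cst_continuous.
by apply: continuousD; [exact: fc|exact: gc].
Qed.

Lemma continuous_bform n (Q : 'M[R]_n) : continuous (fun u => bform Q u u).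
Proof.
under eq_fun do rewrite bformE.
apply: continuous_sum_fun => j u.
apply: continuousM; last exact: coord_continuous.
apply: (@continuous_sum_fun _ _ (fun i (u : 'rV[R]_n) => u 0 i * Q i j)) => i v.
by apply: continuousM; [exact: coord_continuous|exact: cst_continuous].
Qed.

(** The quotient is homogeneous of degree 0, so it is enough to maximize it on
    the unit sphere, which is compact. *)
Lemma quotient_max r (L W : 'M[R]_r) :
  (0 < r)%N -> (forall c, c != 0 -> 0 < bform W c c) ->
  exists2 c0, c0 != 0 & forall c, c != 0 ->
    bform L c c / bform W c c <= bform L c0 c0 / bform W c0 c0.
Proof.
move=> r0 W_gt0; pose S := [set c : 'rV[R]_r | `|c| = 1]%classic.
have nz c : S c -> c != 0.
  by move=> Sc; rewrite -normr_gt0 Sc.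
have sphere c : c != 0 -> S (`|c|^-1 *: c).
  move=> c0; rewrite /S /= normrZ ger0_norm ?invr_ge0// mulVf//.
  by rewrite normr_eq0.
have S0 : (S !=set0)%classic.
  case: r r0 {L W W_gt0 nz} @S sphere => // r _ S sphere.
  exists (`|const_mx 1 : 'rV[R]_r.+1|^-1 *: const_mx 1); apply: sphere.
  by apply/eqP => /rowP/(_ 0); rewrite !mxE; apply/eqP; exact: oner_neq0.
have Sc : compact S.
  apply: bounded_closed_compact.
    by exists 1; split=> // x x1 c /= ->; exact: ltW.
  apply: (@preimage_closed _ _ (fun c : 'rV[R]_r => `|c|)
    [set x : R | x = 1]%classic) => //.
  by move=> c _; exact: norm_continuous.
have [|c0 /set_mem /nz c0_n0 c0_max] :=
  @EVT_max_rV _ _ (fun c => bform L c c / bform W c c) S S0 Sc.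
  apply/continuous_in_subspaceT => c /set_mem/nz c_n0.
  apply: (@continuousM _ _ (fun c => bform L c c) (fun c => (bform W c c)^-1)).
    exact: continuous_bform.
  apply: (@continuousV _ _ (fun c => bform W c c)).
    by rewrite gt_eqF// W_gt0.
  exact: continuous_bform.
exists c0 => // c c_n0.
have := c0_max _ (mem_set (sphere _ c_n0)).
rewrite !(bformZl, bformZr).
have n0 : `|c|^-1 != 0 by rewrite invr_eq0 normr_eq0.
by rewrite !mulrA -!expr2 -mulf_div divff ?mul1r// expf_neq0.
Qed.

End QuotientMax.

Section MinMax.
Context {R : realType} {V : finType} (G : graph R V).
Variables (mu : edgefun G) (nu : nodefun G).
Hypotheses (mu_ge0 : forall e, 0 <= mu 0 e) (nu_ge0 : forall i, 0 <= nu 0 i).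

Local Notation L := (wLaplacian mu).
Local Notation W := (diag_mx nu).
Local Notation K := (common_ker mu nu).

Lemma bform_diag n (w x y : 'rV[R]_n) :
  bform (diag_mx w) x y = \sum_i w 0 i * x 0 i * y 0 i.
Proof.
rewrite /bform mul_mx_diag mxE; apply: eq_bigr => i _; rewrite !mxE.
by rewrite [x 0 i * _]mulrC.
Qed.

Lemma bform_wLaplacian u v :
  bform L u v = bform (diag_mx mu) (grad u) (grad v).
Proof. by rewrite /bform !gradE trmx_mul !mulmxA. Qed.

Lemma sqnormE n (w x : 'rV[R]_n) : sqnorm w x = bform (diag_mx w) x x.
Proof.
rewrite bform_diag; apply: eq_bigr => i _.
by rewrite -normrX ger0_norm ?sqr_ge0// expr2 mulrA.
Qed.

Lemma sqnorm_grad u : sqnorm mu (grad u) = bform L u u.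
Proof. by rewrite sqnormE bform_wLaplacian. Qed.

Lemma bform_diag_ge0 n (w x : 'rV[R]_n) :
  (forall i, 0 <= w 0 i) -> 0 <= bform (diag_mx w) x x.
Proof.
move=> w_ge0; rewrite bform_diag sumr_ge0// => i _.
by rewrite -mulrA -expr2 mulr_ge0 ?sqr_ge0.
Qed.

Lemma bform_diag_eq0 n (w x : 'rV[R]_n) :
  (forall i, 0 <= w 0 i) -> bform (diag_mx w) x x = 0 -> x *m diag_mx w = 0.
Proof.
move=> w_ge0 /eqP; rewrite bform_diag psumr_eq0; last first.
  by move=> i _; rewrite -mulrA -expr2 mulr_ge0 ?sqr_ge0.
move=> /allP x0; apply/rowP => i; have := x0 i (mem_index_enum _).
rewrite mul_mx_diag !mxE /= [x 0 i * _]mulrC mulf_eq0 => /orP[/eqP//|/eqP->].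
by rewrite mulr0.
Qed.

Lemma bform_wLaplacian_ge0 u : 0 <= bform L u u.
Proof. by rewrite bform_wLaplacian bform_diag_ge0. Qed.

(** Both forms are sums of nonnegative terms, so they vanish only termwise. *)
Lemma common_kerP u :
  bform L u u = 0 -> bform W u u = 0 -> (u <= K)%MS.
Proof.
rewrite bform_wLaplacian => /(bform_diag_eq0 mu_ge0) uL.
move=> /(bform_diag_eq0 nu_ge0) uW; rewrite sub_capmx; apply/andP.
split; apply/sub_kermxP => //.
by rewrite /wLaplacian !mulmxA -gradE uL mul0mx.
Qed.

Lemma sub_common_ker m (u : 'M[R]_(m, nb_inner G)) :
  (u <= K)%MS -> u *m L = 0 /\ u *m W = 0.
Proof. by rewrite sub_capmx => /andP[/sub_kermxP ? /sub_kermxP]. Qed.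

Lemma wLaplacian_sym : L^T = L.
Proof. by rewrite /wLaplacian !trmx_mul trmxK tr_diag_mx mulmxA. Qed.

Lemma row_sqr_eq0 n (u : 'rV[R]_n) : u *m u^T = 0 -> u = 0.
Proof.
move=> /matrixP/(_ 0 0); rewrite !mxE => /eqP; rewrite psumr_eq0; last first.
  by move=> i _; rewrite mxE -expr2 sqr_ge0.
move=> /allP u0; apply/rowP => i; have := u0 i (mem_index_enum _).
by rewrite !mxE /= mulf_eq0 orbb => /eqP.
Qed.

(** Excludes the indeterminate case 0 / 0: numerator and denominator vanish
    together only on the common kernel. *)
Lemma orth_common_ker_bform_gt0 u :
  u != 0 -> u *m K^T = 0 -> bform W u u = 0 -> 0 < bform L u u.
Proof.
move=> u0 uK uW; rewrite lt0r bform_wLaplacian_ge0 andbT.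
apply: contraNneq u0 => uL; apply/eqP/row_sqr_eq0.
have /submxP[D {2}->] := common_kerP uL uW.
by rewrite trmx_mul mulmxA uK mul0mx.
Qed.

(** When the denominator vanishes the quotient is +oo, so a finite bound on the
    quotient also says that the denominator is positive. *)
Lemma wRayleigh_lt (lam : R) u :
  u != 0 -> u *m K^T = 0 -> (wRayleigh mu nu u < lam%:E)%E ->
  bform L u u < lam * bform W u u.
Proof.
move=> u0 uK; rewrite /wRayleigh sqnorm_grad sqnormE inver.
case: eqP => [uW|/eqP uW].
  by rewrite gt0_muley ?lte_fin ?orth_common_ker_bform_gt0// ltNge leey.
rewrite -EFinM lte_fin ltr_pdivrMr//.
by rewrite lt0r uW bform_diag_ge0.
Qed.

Definition pencil (lam : R) : 'M[R]_(nb_inner G) := L - lam *: W.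

Lemma pencil_sym lam : (pencil lam)^T = pencil lam.
Proof. by rewrite /pencil linearB /= linearZ /= tr_diag_mx wLaplacian_sym. Qed.

Lemma bform_pencil lam u v :
  bform (pencil lam) u v = bform L u v - lam * bform W u v.
Proof.
by rewrite /bform /pencil mulmxBr mulmxBl -scalemxAr -scalemxAl !mxE.
Qed.

Lemma bform_pencil_ker lam u v :
  (u <= K)%MS -> bform (pencil lam) u v = 0.
Proof.
move/sub_common_ker => [uL uW].
by rewrite bform_pencil !bform_kerl// mulr0 subr0.
Qed.

(** A subspace that nearly attains the infimum defining the [d]-th eigenvalue
    has all its quotients less than [lam], hence is negative definite. *)
Lemma lt_w_eigenvalue_le_index lam d :
  (w_eigenvalue mu nu d < lam%:E)%E -> (d <= negative_index (pencil lam))%N.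
Proof.
move=> /ereal_inf_lt[_ [A [AK dA] <-] sup_lt].
apply: leq_trans dA (rank_le_negative_index _) => u u0 uA.
rewrite bform_pencil subr_lt0 wRayleigh_lt//.
  by have /submxP[D ->] := uA; rewrite -mulmxA AK mulmx0.
by apply: le_lt_trans sup_lt; apply: ereal_sup_ubound; exists u.
Qed.

(** Adding vectors of the common kernel does not change the form, so a negative
    definite subspace can be moved into the orthogonal of that kernel without
    losing dimensions. *)
Lemma neg_definite_orth_common_ker lam (A : 'M[R]_(nb_inner G)) :
  neg_definite_on (pencil lam) A ->
  exists A' : 'M[R]_(nb_inner G), [/\ A' *m K^T = 0,
    (\rank A <= \rank A')%N & neg_definite_on (pencil lam) A'].
Proof.
move=> A_neg; exists ((A + K) :&: kermx K^T)%MS; split.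
- by apply/sub_kermxP; exact: capmxSr.
- have AK0 : (A :&: K)%MS = 0.
    by apply: neg_definite_on_cap A_neg _ => w wK; rewrite bform_pencil_ker.
  have := mxrank_sum_cap A K; rewrite AK0 mxrank0 addn0.
  have := mxrank_sum_cap (A + K)%MS (kermx K^T).
  rewrite mxrank_ker mxrank_tr.
  have := rank_leq_col ((A + K)%MS + kermx K^T)%MS; have := rank_leq_col K.
  lia.
- move=> u u0; rewrite sub_capmx => /andP[/sub_addsmxP[[D E]] /= uE].
  move=> /sub_kermxP uK; have EK : (E *m K <= K)%MS by exact: submxMl.
  rewrite uE !(bformDl, bformDr).
  rewrite [bform _ (D *m A) (E *m _)]bformC ?pencil_sym//.
  rewrite ![bform _ (E *m _) _]bform_pencil_ker// !addr0.
  apply: A_neg (submxMl _ _); apply: contraNneq u0 => a0.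
  apply/eqP/row_sqr_eq0; rewrite {2}uE a0 add0r trmx_mul mulmxA.
  by rewrite uK mul0mx.
Qed.

(** Negativity of the form gives quotients less than [lam] one vector at a time;
    since their supremum on a subspace is attained, it is less than [lam]
    too. *)
Lemma w_eigenvalue_lt_of_neg lam (A : 'M[R]_(nb_inner G)) k :
  (0 < k <= \rank A)%N -> neg_definite_on (pencil lam) A ->
  (w_eigenvalue mu nu k < lam%:E)%E.
Proof.
move=> /andP[k0 kA] /neg_definite_orth_common_ker[B [BK AB B_neg]].
have kB := leq_trans kA AB.
pose M := row_base B.
have M_neg c : c != 0 -> bform (pencil lam) (c *m M) (c *m M) < 0.
  move=> c0; apply: B_neg; last first.
    by rewrite (submx_trans (submxMl _ _))// eq_row_base.
  by rewrite mulmx_free_eq0// row_base_free.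
have W_gt0 c : c != 0 -> 0 < bform (M *m W *m M^T) c c.
  move=> /M_neg; rewrite bform_comp bform_pencil lt0r bform_diag_ge0// andbT.
  apply: contraTneq => ->; rewrite mulr0 subr0.
  by rewrite -leNgt bform_wLaplacian_ge0.
(* The maximum is taken in the coordinates on a basis of B. *)
have rB : (0 < \rank B)%N by exact: leq_trans k0 kB.
have [c0 c0_n0 c0_max] := quotient_max (M *m L *m M^T) rB W_gt0.
set q := _ / _ in c0_max; have q_lt : q < lam.
  rewrite /q ltr_pdivrMr ?W_gt0// (bform_comp L) (bform_comp W).
  rewrite -subr_lt0 -bform_pencil.
  exact: M_neg.
apply: le_lt_trans (_ : _ <= q%:E)%E _; last by rewrite lte_fin.
apply: le_trans (ereal_inf_lbound _) _; first by exists B.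
apply: ge_ereal_sup => _ [u [u0 uB] <-].
have [c uE] : exists c, u = c *m M by apply/submxP; rewrite eq_row_base.
have c_n0 : c != 0 by apply: contraNneq u0 => c0'; rewrite uE c0' mul0mx.
rewrite /wRayleigh sqnorm_grad sqnormE uE -(bform_comp L) -(bform_comp W).
rewrite inver gt_eqF ?W_gt0//.
by rewrite -EFinM lee_fin c0_max.
Qed.

Lemma negative_index_pencil lam k : (0 < k)%N ->
  w_eigenvalue mu nu k = lam%:E ->
  (forall j : nat, (1 <= j < k)%N ->
     (w_eigenvalue mu nu j < w_eigenvalue mu nu k)%E) ->
  negative_index (pencil lam) = k.-1.
Proof.
move=> k0 lamk lt_lam; apply/eqP; rewrite eqn_leq; apply/andP; split.
  have [A rA A_neg] := negative_index_attained (pencil lam).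
  rewrite leqNgt -rA; apply/negP => kA.
  have : (w_eigenvalue mu nu k < lam%:E)%E.
    by apply: w_eigenvalue_lt_of_neg A_neg; rewrite k0 (leq_trans (leqSpred k)).
  by rewrite lamk ltxx.
have [->//|k1] := posnP k.-1.
apply: lt_w_eigenvalue_le_index; rewrite -lamk lt_lam//.
by rewrite k1 ltn_predL.
Qed.

End MinMax.

(** * Second derivatives along lines *)

Section AbsPower.
Context {R : realType}.
Implicit Types (p q x : R).

Lemma continuous_abs_powR0 q :
  0 < q -> {for 0, continuous (fun x => `|x| `^ q)}.
Proof.
move=> q0; rewrite /prop_for /continuous_at normr0 powR0 ?gt_eqF//.
apply/cvgr0Pnorm_lt => e e0.
have d0 : 0 < e `^ q^-1 by rewrite powR_gt0.
near=> x; rewrite ger0_norm ?powR_ge0//.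
rewrite -[e](powRr1 (ltW e0)) -(@mulVf _ q) ?gt_eqF// powRrM.
by apply: gt0_ltr_powR; rewrite ?nnegrE ?powR_ge0//; near: x; exact: nbhs0_lt.
Unshelve. all: by end_near. Qed.

Lemma is_derive_odd (h : R -> R) x d :
  (forall y, h (- y) = - h y) -> is_derive (- x) 1 h d -> is_derive x 1 h d.
Proof.
move=> h_odd h_der.
have -> : h = - (h \o -%R) by apply/funext => y; rewrite fctE /= h_odd opprK.
by apply: is_derive_eq; rewrite mulrN1 opprK.
Qed.

(** Both derivatives of |x|^p follow from this one, since |x|^p is the product
    of |x|^(p-2) x and x.  At 0 the difference quotient is |x|^q itself. *)
Lemma is_derive_abs_powR_id q x : 0 < q ->
  is_derive x 1 (fun y => `|y| `^ q * y) ((q + 1) * `|x| `^ q).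
Proof.
move=> q0; have pos (y : R) : 0 < y ->
    is_derive y 1 (fun y => `|y| `^ q * y) ((q + 1) * `|y| `^ q).
  move=> y0; apply: (@near_eq_is_derive _ _ _ (fun y : R => y `^ q * y)).
    by near=> z; rewrite gtr0_norm//; near: z; exact: lt_nbhsr.
  have dy := @is_derive1_powR R q y y0.
  apply: (@is_derive_eq _ _ _ ((@powR R ^~ q) * id)).
  rewrite gtr0_norm// /GRing.scale /= mulr1 [y * (_ * _)]mulrCA.
  by rewrite mulr_powRB1 ?ltW//; ring.
have [x0|x0|->] := ltgtP x 0; last first.
- rewrite normr0 powR0 ?gt_eqF// mulr0; apply/is_derive1_caratheodory.
  exists (fun z => `|z| `^ q); split.
  + by move=> z; rewrite mulr0 !subr0.
  + exact: continuous_abs_powR0.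
  + by rewrite normr0 powR0// gt_eqF.
- exact: pos.
- apply: is_derive_odd => [y|]; first by rewrite normrN mulrN.
  by rewrite -normrN; apply: pos; rewrite oppr_gt0.
Unshelve. all: by end_near. Qed.

Lemma abs_powR2 p x : 0 < p - 2 -> `|x| `^ p = `|x| `^ (p - 2) * x ^+ 2.
Proof.
move=> p2; rewrite -[x ^+ 2]ger0_norm ?sqr_ge0// normrX -powR_mulrn//.
have [->|x0] := eqVneq x 0.
  by rewrite normr0 !powR0 ?mulr0// gt_eqF//; lra.
by rewrite -powRD ?normr_eq0 ?x0 ?implybT// subrK.
Qed.

Lemma is_derive_abs_powR p x : 2 < p ->
  is_derive x 1 (fun y => `|y| `^ p) (p * (`|x| `^ (p - 2) * x)).
Proof.
move=> p2; have q0 : 0 < p - 2 by rewrite subr_gt0.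
have -> : (fun y => `|y| `^ p) = (fun y => `|y| `^ (p - 2) * y) * id.
  by apply/funext => y; rewrite abs_powR2// expr2 mulrA.
have := is_derive_abs_powR_id x q0 => ?; apply: is_derive_eq.
by rewrite /GRing.scale /=; ring.
Qed.

End AbsPower.

Section SecondDerivative.
Context {R : realType}.

Lemma derive_line n (phi : 'rV[R]_n -> R) (x u : 'rV[R]_n) t :
  'D_u phi (t *: u + x) = 'D_1 (fun s : R => phi (s *: u + x)) t.
Proof.
rewrite /derive; set F := (F in lim (fmap F _)).
set F' := (F in _ = lim (fmap F _)).
suff -> : F = F' by [].
apply/funext => h; rewrite /F /F' /=.
by rewrite addrA -scalerDl [h *: 1]mulr1.
Qed.

(** The diagonal values of the Hessian only involve the restriction to one line,
    so no differentiability in several variables is needed. *)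
Lemma hessian_line n (phi : 'rV[R]_n -> R) (x u : 'rV[R]_n)
    (F F1 : R -> R) (F2 : R) :
  (\forall t \near 0, phi (t *: u + x) = F t) ->
  (\forall t \near 0, is_derive (t : R) 1 F (F1 t)) ->
  is_derive (0 : R) 1 F1 F2 ->
  hessian phi x u u = F2.
Proof.
move=> phiF FF1 F1F2; rewrite /hessian -{1}[x]add0r -(scale0r u).
rewrite derive_line -[RHS](@derive_val _ _ _ _ _ _ _ F1F2).
apply: near_eq_derive; near=> t; rewrite derive_line.
have Ft : is_derive t 1 F (F1 t) by near: t.
rewrite -[RHS](@derive_val _ _ _ _ _ _ _ Ft).
by apply: near_eq_derive; near: t; have := near_join phiF.
Unshelve. all: by end_near. Qed.

(** With quotient [lam] and P' = lam Q' at [t], the derivative of the quotient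
    vanishes there, and the terms with Q'^2 cancel in the second derivative. *)
Lemma is_derive2_quotient (P Q P1 Q1 : R -> R) (P2 Q2 lam t : R) :
  (forall s : R, is_derive s 1 P (P1 s)) ->
  (forall s : R, is_derive s 1 Q (Q1 s)) ->
  is_derive t 1 P1 P2 -> is_derive t 1 Q1 Q2 ->
  Q t != 0 -> P t = lam * Q t -> P1 t = lam * Q1 t ->
  exists2 F1,
    \forall s \near t, is_derive (s : R) 1 (fun s => P s / Q s) (F1 s) &
    is_derive t 1 F1 ((P2 - lam * Q2) / Q t).
Proof.
move=> dP dQ dP1 dQ1 Qt Pt P1t.
have quot (A B : R -> R) (A1 B1 s : R) :
    is_derive s 1 A A1 -> is_derive s 1 B B1 -> B s != 0 ->
    is_derive s 1 (fun s => A s / B s) ((A1 * B s - A s * B1) / B s ^+ 2).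
  move=> dA dB Bs; have dV := is_deriveV Bs dB.
  apply: (@is_derive_eq _ _ _ (A * (fun s => (B s)^-1))).
  by rewrite /GRing.scale /=; field.
exists (fun s => (P1 s * Q s - P s * Q1 s) / Q s ^+ 2).
  have Qc : {for t, continuous Q}.
    apply/differentiable_continuous/derivable1_diffP.
    exact: (@ex_derive _ _ _ _ _ _ _ (dQ t)).
  near=> s; apply: quot => //; near: s.
  exact: (cvgr_neq0 (Q t)).
have dN : is_derive t 1 (fun s => P1 s * Q s - P s * Q1 s)
    (P2 * Q t - P t * Q2).
  apply: (@is_derive_eq _ _ _ (P1 * Q - P * Q1)).
  by rewrite /GRing.scale /=; ring.
have dD : is_derive t 1 (fun s => Q s ^+ 2) (2 * Q t * Q1 t).
  apply: (@is_derive_eq _ _ _ (Q ^+ 2)).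
  by rewrite /GRing.scale /= expr1.
apply: is_derive_eq (quot _ _ _ _ _ dN dD _) _; first by rewrite expf_neq0.
by rewrite Pt P1t; field.
Unshelve. all: by end_near. Qed.

Lemma is_derive_energy n (w a b : 'I_n -> R) (phi dphi : R -> R) (t : R) :
  (forall x : R, is_derive x 1 phi (dphi x)) ->
  is_derive t 1 (fun s => \sum_i w i * phi (a i + s * b i))
    (\sum_i w i * b i * dphi (a i + t * b i)).
Proof.
move=> dphi_phi.
have -> : (fun s => \sum_i w i * phi (a i + s * b i)) =
    \sum_i (fun s => w i * phi (a i + s * b i)).
  by apply/funext => s; rewrite fct_sumE.
apply: is_derive_sum => i.
have d1 : is_derive t 1 (fun s : R => a i + s * b i) (b i).
  apply: (@is_derive_eq _ _ _ (cst (a i) + id * cst (b i))).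
  by rewrite /GRing.scale /=; ring.
have := @is_derive1_comp _ phi _ _ _ _ (dphi_phi _) d1 => d2.
apply: (@is_derive_eq _ _ _ (w i \*: (phi \o (fun s : R => a i + s * b i)))).
by rewrite /GRing.scale /=; ring.
Qed.

End SecondDerivative.

(** * Hessians of the Rayleigh quotients *)

Lemma morse_index_hessian {R : realType} n (Phi : 'rV[R]_n -> R) x Q c :
  0 < c -> (forall u, hessian Phi x u u = c * bform Q u u) ->
  morse_index Phi x = negative_index Q.
Proof.
move=> c0 hess; apply: eq_bigl => d; apply: asbool_equiv_eq; split.
  move=> [A [rA A_neg]]; exists A; split=> // u u0 uA.
  by have := A_neg u u0 uA; rewrite hess pmulr_rlt0.
move=> [A [rA A_neg]]; exists A; split=> // u u0 uA.
by rewrite hess pmulr_rlt0// A_neg.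
Qed.

Section Hessian.
Context {R : realType} {V : finType} (G : graph R V).
Variables (mu : edgefun G) (nu f : nodefun G) (lam : R).
Hypotheses (fnu_gt0 : 0 < sqnorm nu f) (f_eig : w_eigenpair mu nu lam f).

Local Notation L := (wLaplacian mu).
Local Notation W := (diag_mx nu).

Lemma w_eigenpair_bform u : bform L f u = lam * bform W f u.
Proof.
by case: f_eig => _; rewrite /bform => ->; rewrite -scalemxAl mxE.
Qed.

(** Common to both quotients: [phi] is |x|^p with unit weights, or x^2 with the
    weights [mu] and [nu].  The hypotheses say that at [f] the weighted values
    of [phi] and of its derivatives are those of the quadratic energies, up to
    the constants [c1] and [c2].  The factor [s] serves for the opposite
    function. *)
Lemma hessian_energy_quotient (wE : 'I_(nb_edges G) -> R)
    (wN : 'I_(nb_inner G) -> R) (phi phi1 phi2 : R -> R) (c1 c2 s : R)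
    (Phi : nodefun G -> R) u :
  (forall x : R, is_derive x 1 phi (phi1 x)) ->
  (forall x : R, is_derive x 1 phi1 (phi2 x)) ->
  (forall e, [/\ wE e * phi (grad f 0 e) = mu 0 e * grad f 0 e ^+ 2,
    wE e * phi1 (grad f 0 e) = c1 * (mu 0 e * grad f 0 e) &
    wE e * phi2 (grad f 0 e) = c2 * mu 0 e]) ->
  (forall i, [/\ wN i * phi (f 0 i) = nu 0 i * f 0 i ^+ 2,
    wN i * phi1 (f 0 i) = c1 * (nu 0 i * f 0 i) &
    wN i * phi2 (f 0 i) = c2 * nu 0 i]) ->
  (forall g, Phi g = s * ((\sum_e wE e * phi (grad g 0 e)) /
                          (\sum_i wN i * phi (g 0 i)))) ->
  hessian Phi f u u =
    s * (c2 / sqnorm nu f * bform (pencil mu nu lam) u u).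
Proof.
move=> dphi dphi1 wEphi wNphi PhiE.
pose en n (w a b : 'I_n -> R) t := \sum_i w i * phi (a i + t * b i).
pose en1 n (w a b : 'I_n -> R) t := \sum_i w i * b i * phi1 (a i + t * b i).
have den n w a b (t : R) : is_derive t 1 (en n w a b) (en1 n w a b t).
  exact: is_derive_energy.
have en2 n (w a b m : 'I_n -> R) :
    (forall i, [/\ w i * phi (a i) = m i * a i ^+ 2,
      w i * phi1 (a i) = c1 * (m i * a i) & w i * phi2 (a i) = c2 * m i]) ->
    [/\ en n w a b 0 = \sum_i m i * a i * a i,
      en1 n w a b 0 = c1 * \sum_i m i * a i * b i &
      is_derive (0 : R) 1 (en1 n w a b) (c2 * \sum_i m i * b i * b i)].
  move=> wphi; split.
  - apply: eq_bigr => i _; rewrite mul0r addr0; have [-> _ _] := wphi i.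
    by rewrite expr2 mulrA.
  - rewrite mulr_sumr; apply: eq_bigr => i _; rewrite mul0r addr0 mulrAC.
    by have [_ -> _] := wphi i; rewrite !mulrA.
  - apply: is_derive_eq (is_derive_energy _ _ _ _ dphi1) _.
    rewrite mulr_sumr; apply: eq_bigr => i _; rewrite mul0r addr0.
    have [_ _ ci] := wphi i.
    by rewrite -[w i * b i * b i]mulrA mulrAC ci !mulrA.
have [P0 P1 dP1] := en2 _ wE (grad f 0) (grad u 0) (mu 0) wEphi.
have [Q0 Q1 dQ1] := en2 _ wN (f 0) (u 0) (nu 0) wNphi.
rewrite -!bform_diag -!bform_wLaplacian in P0 P1 dP1.
rewrite -!bform_diag in Q0 Q1 dQ1; have := fnu_gt0; rewrite sqnormE => ff_gt0.
have [|||F1 dF dF1] := is_derive2_quotient (lam := lam) (t := 0)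
  (den _ wE (grad f 0) (grad u 0)) (den _ wN (f 0) (u 0)) dP1 dQ1.
- by rewrite Q0 gt_eqF.
- by rewrite P0 Q0 w_eigenpair_bform.
- by rewrite P1 Q1 w_eigenpair_bform mulrCA.
apply: (@hessian_line _ _ _ _ _
  (s \*: (fun t => en _ wE (grad f 0) (grad u 0) t / en _ wN (f 0) (u 0) t))
  (s \*: F1)).
- near=> t; rewrite PhiE /GRing.scale /=; congr (_ * (_ / _)).
    by apply: eq_bigr => e _; rewrite linearP !mxE addrC.
  by apply: eq_bigr => i _; rewrite !mxE addrC.
- near=> t.
  have dt : is_derive t 1 (fun t => en _ wE (grad f 0) (grad u 0) t /
    en _ wN (f 0) (u 0) t) (F1 t) by near: t.
  exact: is_deriveZ.
- apply: is_derive_eq; rewrite /GRing.scale /= Q0 bform_pencil.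
  by field; rewrite gt_eqF.
Unshelve. all: by end_near. Qed.

(** For a zero denominator both sides are 0: [fine] sends an infinite value to
    0, and the real inverse of 0 is 0. *)
Lemma fine_wRayleigh (g : nodefun G) :
  fine (wRayleigh mu nu g) = sqnorm mu (grad g) / sqnorm nu g.
Proof.
rewrite /wRayleigh inver; case: eqP => [->|_] //; rewrite invr0 mulr0.
by rewrite mulry; case: sgrP => _; rewrite ?mul0e ?mul1e ?mulN1e.
Qed.

Lemma hessian_wRayleigh s u :
  hessian (fun g => s * fine (wRayleigh mu nu g)) f u u =
    s * (2 / sqnorm nu f * bform (pencil mu nu lam) u u).
Proof.
apply: (hessian_energy_quotient (phi := fun x => x ^+ 2)
  (phi1 := fun x => 2 * x) (phi2 := fun=> 2) (c1 := 2)
  (wE := mu 0) (wN := nu 0)).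
- move=> x; apply: (@is_derive_eq _ R _ ((id : R -> R) ^+ 2)).
  by rewrite /GRing.scale /= mulr1 expr1.
- move=> x; apply: (@is_derive_eq _ R _ (2 \*: (id : R -> R))).
  by rewrite /GRing.scale /= mulr1.
- by move=> e; split=> //; ring.
- by move=> i; split=> //; ring.
- move=> g; rewrite fine_wRayleigh; congr (_ * (_ / _));
  by apply: eq_bigr => i _; rewrite real_normK ?num_real.
Qed.

End Hessian.

Lemma abs_powE {R : realType} n (q : R) (x : 'rV[R]_n) i :
  abs_pow q x 0 i = `|x 0 i| `^ q.
Proof. by rewrite mxE. Qed.

Lemma sqnorm_abs_pow {R : realType} n (p : R) (x : 'rV[R]_n) :
  2 < p -> sqnorm (abs_pow (p - 2) x) x = \sum_i `|x 0 i| `^ p.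
Proof.
move=> p2; apply: eq_bigr => i _; rewrite mxE real_normK ?num_real//.
by rewrite abs_powR2// subr_gt0.
Qed.

Lemma hessian_pRayleigh {R : realType} {V : finType} (G : graph R V)
    (p lam s : R) (f u : nodefun G) :
  let nu := abs_pow (p - 2) f in
  let mu := abs_pow (p - 2) (grad f) in
  2 < p -> 0 < sqnorm nu f -> w_eigenpair mu nu lam f ->
  hessian (fun g => s * pRayleigh p g) f u u =
    s * (p * (p - 1) / sqnorm nu f * bform (pencil mu nu lam) u u).
Proof.
move=> nu mu p2 fnu_gt0 f_eig; have q0 : 0 < p - 2 by rewrite subr_gt0.
apply: (hessian_energy_quotient fnu_gt0 f_eig (phi := fun x => `|x| `^ p)
  (phi1 := fun x => p * (`|x| `^ (p - 2) * x))
  (phi2 := fun x => p * ((p - 1) * `|x| `^ (p - 2))) (c1 := p)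
  (wE := fun=> 1) (wN := fun=> 1)).
- by move=> x; exact: is_derive_abs_powR.
- move=> x; have dx := is_derive_abs_powR_id x q0.
  apply: (@is_derive_eq _ _ _ (p \*: (fun y => `|y| `^ (p - 2) * y))).
  by rewrite /GRing.scale /=; ring.
- by move=> e; rewrite !mul1r abs_powE abs_powR2//; split=> //; ring.
- by move=> i; rewrite !mul1r abs_powE abs_powR2//; split=> //; ring.
- by move=> g; congr (_ * (_ / _)); apply: eq_bigr => i _; rewrite mul1r.
Qed.

Theorem proposition3p4 (R : realType) (V : finType) (G : graph R V)
    (p lam : R) (f : nodefun G) (k m : nat) :
  let N := nb_inner G in
  let nu := abs_pow (p - 2) f in
  let mu := abs_pow (p - 2) (grad f) in
  let R2 := fun g : nodefun G => fine (wRayleigh mu nu g) in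
  2 < p ->
  p_eigenpair p lam f ->
  (1 <= k <= N - \rank (common_ker mu nu))%N ->
  w_eigenpair mu nu lam f ->
  w_eigenvalue mu nu k = lam%:E ->
  (forall j : nat, (1 <= j < k)%N ->
     (w_eigenvalue mu nu j < w_eigenvalue mu nu k)%E) ->
  w_multiplicity mu nu lam = m ->
  [/\ morse_index (pRayleigh p) f = morse_index R2 f,
      (morse_index R2 f)%:Z = k%:Z - 1,
      morse_index (fun g : nodefun G => - pRayleigh p g) f =
        morse_index (fun g : nodefun G => - R2 g) f
    & (morse_index (fun g : nodefun G => - R2 g) f)%:Z =
        N%:Z - k%:Z - m%:Z + 1].
Proof.
move=> N nu mu R2 p2 [f0 _] /andP[k0 _] f_eig lamk lt_lam mult.
have pow_ge0 n (x : 'rV[R]_n) i : 0 <= abs_pow (p - 2) x 0 i.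
  by rewrite mxE powR_ge0.
have fnu_gt0 : 0 < sqnorm nu f.
  rewrite sqnorm_abs_pow// lt0r sumr_ge0 ?andbT; last first.
    by move=> *; exact: powR_ge0.
  rewrite psumr_eq0; last by move=> *; exact: powR_ge0.
  apply: contraNN f0 => /allP f_eq0; apply/eqP/rowP => i.
  have := f_eq0 i (mem_index_enum _); rewrite powR_eq0 mxE normr_eq0.
  by case/andP => /eqP.
have c2 : 0 < 2 / sqnorm nu f by rewrite divr_gt0.
have cp : 0 < p * (p - 1) / sqnorm nu f by rewrite divr_gt0// mulr_gt0; lra.
pose Q := pencil mu nu lam.
have hess2 s u := hessian_wRayleigh fnu_gt0 f_eig s u.
have hessp s u : hessian (fun g => s * pRayleigh p g) f u u = _ :=
  hessian_pRayleigh s u p2 fnu_gt0 f_eig.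
have pos1 (Phi : nodefun G -> R) : Phi = (fun g => 1 * Phi g).
  by apply/funext => g; rewrite mul1r.
have neg1 (Phi : nodefun G -> R) : (fun g => - Phi g) = (fun g => -1 * Phi g).
  by apply/funext => g; rewrite mulN1r.
have mi2 : morse_index R2 f = negative_index Q.
  by apply: (morse_index_hessian c2) => u; rewrite (pos1 R2) hess2 mul1r.
have mip : morse_index (pRayleigh p) f = negative_index Q.
  apply: (morse_index_hessian cp) => u.
  by rewrite (pos1 (pRayleigh p)) hessp mul1r.
have mi2N : morse_index (fun g => - R2 g) f = negative_index (- Q).
  apply: (morse_index_hessian c2) => u.
  by rewrite neg1 hess2 bformN mulrN mulN1r.
have mipN : morse_index (fun g => - pRayleigh p g) f = negative_index (- Q).
  apply: (morse_index_hessian cp) => u.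
  by rewrite neg1 hessp bformN mulrN mulN1r.
have nQ : negative_index Q = k.-1.
  by apply: (negative_index_pencil _ _ k0 lamk lt_lam) => i; exact: pow_ge0.
have := inertia (pencil_sym mu nu lam); rewrite -/Q nQ.
have -> : \rank (kermx Q) = m by [].
rewrite mip mi2 mi2N mipN nQ -/N.
clear -k0 => sumN.
by split=> //; lia.
Qed.
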